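(* Let $p\geq 1$ be an integer and let $(a_n^{(k)})_{n\in\mathbb{Z}}$, $0\leq k\leq p$, be bi-infinite sequences of complex numbers. With the lattice paths, weights and formal power series defined in the context, the following identities hold in the field $\mathbb{C}((z^{-1}))$: \[ A_{0}(z)=\frac{1}{z-a_{0}^{(0)}-\sum_{j=1}^{p}a_{0}^{(j)}\,A_{j-1}^{(1)}(z)},\qquad A_{j}(z)=A_{0}(z)\,A^{(1)}_{j-1}(z)\quad (1\leq j\leq p). \]
   Context: $\mathbb{C}((z^{-1}))$ denotes the field of formal series $\sum_{n\in\mathbb{Z}} c_n z^{-n}$ with complex coefficients and only finitely many nonzero $c_n$ with $n<0$. Lattice paths have vertices in $\mathbb{Z}_{\geq 0}\times\mathbb{Z}$ and are finite sequences of steps, consecutive steps sharing endpoints; the allowed steps are upsteps $(n,m)\to(n+1,m+1)$, level steps $(n,m)\to(n+1,m)$, and downsteps $(n,m)\to(n+1,m-j)$ with $1\leq j\leq p$. The length of a path is its number of steps (a path of length $0$ is a single vertex). Weights: every upstep has weight $1$; a step $(n,m)\to(n+1,m-j)$ with $0\leq j\leq p$ has weight $a_{m-j}^{(j)}$. The weight $w(\gamma)$ of a path is the product of the weights of its steps ($1$ for a path of length $0$). For an integer $q$, $\gamma+q$ denotes the path shifted vertically by $q$ units. $\min(\gamma)$ is the minimal height (second coordinate) of the vertices of $\gamma$. For $n\geq0$ and $0\leq j\leq p$, $\mathcal{D}_{[n,j]}$ is the set of paths of length $n$ from $(0,0)$ to $(n,j)$ with $\min(\gamma)=0$. For integers $q\geq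 0$ put $A_{[n,j]}^{(q)}=\sum_{\gamma\in\mathcal{D}_{[n,j]}}w(\gamma+q)$ (an empty sum is $0$), $A_{[n,j]}=A_{[n,j]}^{(0)}$, and define the formal series $A_j^{(q)}(z)=\sum_{n=0}^\infty A^{(q)}_{[n,j]}z^{-n-1}$, $A_j(z)=A_j^{(0)}(z)$. *)

(* Defs.v *)
From HB Require Import structures.
From mathcomp Require Import all_boot all_order all_algebra.
From mathcomp Require Import boolp classical_sets functions cardinality fsbigop.
From mathcomp Require Import reals.
From mathcomp Require Export complex.
From mathcomp Require Import zify.

Set Implicit Arguments.
Unset Strict Implicit.
Unset Printing Implicit Defensive.

Import Order.TTheory GRing.Theory Num.Theory.

Local Open Scope classical_set_scope.
Local Open Scope ring_scope.

(** * The field F((z^-1)) *)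

(* [lcoef f n] is the coefficient of z^(-n), so [n < 0] are the positive powers
   of z. *)
Record laurent (F : fieldType) := Laurent {
  lcoef :> int -> F;
  lcoef_finite : finite_set [set n : int | n < 0 /\ lcoef n != 0] }.

HB.instance Definition _ (F : fieldType) := gen_eqMixin (laurent F).
HB.instance Definition _ (F : fieldType) := gen_choiceMixin (laurent F).

Section LaurentField.
Variable F : fieldType.
Implicit Types (f g h : int -> F) (x y : laurent F).

Lemma laurentP x y : (forall n, x n = y n) -> x = y.
Proof.
case: x y => [f Pf] [g Pg] /= /funext fg; rewrite fg in Pf *.
by rewrite (Prop_irrelevance Pf Pg).
Qed.

Definition lbounded f (v : int) := forall n, n < v -> f n = 0.

Lemma lboundedW f v w : w <= v -> lbounded f v -> lbounded f w.
Proof. by move=> wv fv n nw; apply: fv; exact: lt_le_trans wv. Qed.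

Lemma finite_lbounded f :
  finite_set [set n : int | n < 0 /\ f n != 0] <-> exists v, lbounded f v.
Proof.
split=> [/finite_seqP[s sE]|[v fv]].
  exists (- (\sum_(i <- s) `|i|%N)%:Z) => n nlt.
  apply/eqP/negPn/negP => fn0.
  have : [set` s] n by rewrite -sE /=; split => //; lia.
  rewrite /= => ns; move: nlt; rewrite (big_rem n)//=; lia.
apply: (@sub_finite_set _ _ [set` [seq - (i%:Z) | i <- iota 0 `|v|%N.+1]]).
  move=> n [n0 fn0]; apply/mapP; exists `|n|%N; last by lia.
  rewrite mem_iota add0n ltnS leq0n /=.
  have : v <= n by rewrite leNgt; apply/negP => /fv; apply/eqP.
  by lia.
exact: finite_seq.
Qed.

Lemma laurent_lbounded x : exists v, lbounded x v.
Proof. exact/finite_lbounded/lcoef_finite. Qed.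

Definition lconv f g (n : int) : F := \sum_(i \in [set: int]) f i * g (n - i).

Definition ltrunc f (v : int) K : {poly F} := \poly_(i < K) f (v + i%:Z).

Lemma lconv_sum f g v w (k : nat) : lbounded f v -> lbounded g w ->
  lconv f g (v + w + k%:Z) =
  \sum_(i < k.+1) f (v + i%:Z) * g (w + (k - i)%N%:Z).
Proof.
move=> fv gw; rewrite /lconv.
rewrite (fsbigE [seq v + i%:Z | i <- iota 0 k.+1]) //; first last.
- move=> i _ iNs; case: (ltP i v) => [/fv ->|vi]; first by rewrite mul0r.
  have [kl|kl] := ltP (v + w + k%:Z - i) w; first by rewrite (gw _ kl) mulr0.
  case/negP: iNs; apply/mapP; exists (absz (i - v)%R); last by lia.
  by rewrite mem_iota; lia.
- by rewrite map_inj_uniq ?iota_uniq// => i j /addrI [].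
rewrite big_map -[iota _ _]/(index_iota 0 k.+1) big_mkord.
apply: eq_big => [i|i _]; first by rewrite in_setT.
by congr (_ * g _); have := ltn_ord i; lia.
Qed.

Lemma lconv_poly f g v w K (k : nat) : lbounded f v -> lbounded g w ->
  (k < K)%N -> lconv f g (v + w + k%:Z) = (ltrunc f v K * ltrunc g w K)`_k.
Proof.
move=> fv gw kK; rewrite lconv_sum// coefM; apply: eq_bigr => i _.
have := ltn_ord i => ik; rewrite !coef_poly !ifT//; lia.
Qed.

Lemma lbounded_conv f g v w : lbounded f v -> lbounded g w ->
  lbounded (lconv f g) (v + w).
Proof.
move=> fv gw n nvw; rewrite /lconv fsbig1 // => i _.
case: (ltP i v) => [/fv ->|vi]; first by rewrite mul0r.
by rewrite (gw (n - i)) ?mulr0//; lia.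
Qed.

Lemma coef_trunc_conv f g v w K (p : {poly F}) (k : nat) :
    lbounded f v -> lbounded g w -> (k < K)%N ->
  (ltrunc (lconv f g) (v + w) K * p)`_k =
  (ltrunc f v K * ltrunc g w K * p)`_k.
Proof.
move=> fv gw kK; rewrite !coefM; apply: eq_bigr => i _; congr (_ * _).
have iK : (i < K)%N by have := ltn_ord i; lia.
by rewrite -lconv_poly// coef_poly iK.
Qed.

Lemma lconvC f g v w : lbounded f v -> lbounded g w ->
  lconv f g =1 lconv g f.
Proof.
move=> fv gw n; case: (ltP n (v + w)) => nvw.
  by rewrite (lbounded_conv fv gw)// (lbounded_conv gw fv)// addrC.
have -> : n = v + w + (absz (n - (v + w))%R)%:Z by lia.
by rewrite (lconv_poly fv gw (ltnSn _)) mulrC [v + w]addrC -lconv_poly.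
Qed.

Lemma lconvA f g h u v w : lbounded f u -> lbounded g v -> lbounded h w ->
  lconv f (lconv g h) =1 lconv (lconv f g) h.
Proof.
move=> fu gv hw n; have gh := lbounded_conv gv hw; have fg := lbounded_conv fu gv.
case: (ltP n (u + v + w)) => nuvw.
  by rewrite (lbounded_conv fg hw)// (lbounded_conv fu gh)// addrA.
have -> : n = u + v + w + (absz (n - (u + v + w))%R)%:Z by lia.
move: (absz _) => k; rewrite (lconv_poly fg hw (ltnSn _)) coef_trunc_conv//.
rewrite -[u + v + w]addrA (lconv_poly fu gh (ltnSn _)).
by rewrite [ltrunc f _ _ * ltrunc (lconv _ _) _ _]mulrC coef_trunc_conv// mulrC mulrA.
Qed.

Lemma lconvDl f g h v w : lbounded f v -> lbounded g v -> lbounded h w ->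
  lconv (fun n => f n + g n) h =1 (fun n => lconv f h n + lconv g h n).
Proof.
move=> fv gv hw n.
have fgv : lbounded (fun n => f n + g n) v.
  by move=> m mv; rewrite fv// gv// addr0.
case: (ltP n (v + w)) => nvw.
  rewrite (lbounded_conv fgv hw)//.
  by rewrite (lbounded_conv fv hw)// (lbounded_conv gv hw)// addr0.
have -> : n = v + w + (absz (n - (v + w))%R)%:Z by lia.
rewrite !lconv_sum// -big_split; apply: eq_bigr => i _.
exact: mulrDl.
Qed.

(* c z^(-m) *)
Definition lmonom (c : F) (m n : int) : F := if n == m then c else 0.

Lemma lmonom_finite c m : finite_set [set n : int | n < 0 /\ lmonom c m n != 0].
Proof.
apply/finite_lbounded; exists m => n nm.
by rewrite /lmonom ifN//; lia.
Qed.

Lemma lconv1 f : lconv (lmonom 1 0) f =1 f.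
Proof.
move=> n; rewrite /lconv (fsbigE [:: 0 : int])//; last first.
  by move=> i _; rewrite inE /lmonom => /negbTE ->; rewrite mul0r.
by rewrite big_cons big_nil in_setT /= /lmonom eqxx mul1r subr0 addr0.
Qed.

(* Recursion for the power series inverse: u_0 = 1/b_0 and
   u_(k+1) = - (1/b_0) \sum_(i <= k) b_(i+1) u_(k-i). *)
Fixpoint pinvs (b : nat -> F) (k : nat) : seq F :=
  if k is k'.+1 then
    let s := pinvs b k' in
    rcons s (- ((b 0)^-1 * \sum_(i < k'.+1) b i.+1 * nth 0 s (k' - i)%N))
  else [:: (b 0)^-1].

Definition pinv b k := nth 0 (pinvs b k) k.

Lemma size_pinvs b k : size (pinvs b k) = k.+1.
Proof. by elim: k => //= k IH; rewrite size_rcons IH. Qed.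

Lemma nth_pinvs b k i : (i <= k)%N -> nth 0 (pinvs b k) i = pinv b i.
Proof.
elim: k => [|k IH]; first by rewrite leqn0 => /eqP ->.
rewrite leq_eqVlt => /predU1P[-> //|]; rewrite ltnS => ik.
by rewrite /= nth_rcons size_pinvs ltnS ik IH.
Qed.

Lemma pinvP b k : b 0%N != 0 ->
  \sum_(i < k.+1) b i * pinv b (k - i)%N = (k == 0%N)%:R.
Proof.
move=> b0; case: k => [|k].
  by rewrite big_ord1 /pinv /= mulfV.
rewrite big_ord_recl subn0 /= {1}/pinv /= nth_rcons size_pinvs ltnn eqxx.
rewrite mulrN mulrA mulfV// mul1r addrC; apply/eqP; rewrite subr_eq0; apply/eqP.
apply: eq_bigr => i _; rewrite /bump /= add1n subSS; congr (_ * _).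
by rewrite nth_pinvs// leq_subr.
Qed.

Fact laurent0_subproof : finite_set [set n : int | n < 0 /\ (0 : F) != 0].
Proof. by apply/finite_lbounded; exists 0. Qed.
Fact laurentN_subproof x : finite_set [set n : int | n < 0 /\ - x n != 0].
Proof.
have [v xv] := laurent_lbounded x; apply/finite_lbounded; exists v => n nv.
by rewrite xv// oppr0.
Qed.
Lemma laurent_lbounded2 x y : exists v, lbounded x v /\ lbounded y v.
Proof.
have [v xv] := laurent_lbounded x; have [w yw] := laurent_lbounded y.
by exists (Order.min v w); split; [apply: lboundedW xv | apply: lboundedW yw];
  rewrite ge_min lexx ?orbT.
Qed.
Fact laurentD_subproof x y : finite_set [set n : int | n < 0 /\ x n + y n != 0].
Proof.
have [v [xv yv]] := laurent_lbounded2 x y.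
by apply/finite_lbounded; exists v => n nv; rewrite xv// yv// addr0.
Qed.
Fact laurentM_subproof x y : finite_set [set n : int | n < 0 /\ lconv x y n != 0].
Proof.
have [v [xv yv]] := laurent_lbounded2 x y.
by apply/finite_lbounded; exists (v + v); exact: lbounded_conv.
Qed.

Definition laurent_zero : laurent F := Laurent laurent0_subproof.
Definition laurent_opp x : laurent F := Laurent (laurentN_subproof x).
Definition laurent_add x y : laurent F := Laurent (laurentD_subproof x y).
Definition laurent_mul x y : laurent F := Laurent (laurentM_subproof x y).
Definition laurent_monom c m : laurent F := Laurent (lmonom_finite c m).

Fact laurent_addA : associative laurent_add.
Proof. by move=> x y z; apply: laurentP => n /=; rewrite addrA. Qed.
Fact laurent_addC : commutative laurent_add.
Proof. by move=> x y; apply: laurentP => n /=; rewrite addrC. Qed.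
Fact laurent_add0 : left_id laurent_zero laurent_add.
Proof. by move=> x; apply: laurentP => n /=; rewrite add0r. Qed.
Fact laurent_addN : left_inverse laurent_zero laurent_opp laurent_add.
Proof. by move=> x; apply: laurentP => n /=; rewrite addNr. Qed.

HB.instance Definition _ := GRing.isZmodule.Build (laurent F)
  laurent_addA laurent_addC laurent_add0 laurent_addN.

Fact laurent_mulA : associative laurent_mul.
Proof.
move=> x y z; apply: laurentP.
have [u xu] := laurent_lbounded x; have [v yv] := laurent_lbounded y.
have [w zw] := laurent_lbounded z; exact: lconvA xu yv zw.
Qed.
Fact laurent_mulC : commutative laurent_mul.
Proof.
move=> x y; apply: laurentP; have [v [xv yv]] := laurent_lbounded2 x y.
exact: lconvC xv yv.
Qed.
Fact laurent_mul1 : left_id (laurent_monom 1 0) laurent_mul.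
Proof. by move=> x; apply: laurentP; exact: lconv1. Qed.
Fact laurent_mulDl : left_distributive laurent_mul +%R.
Proof.
move=> x y z; apply: laurentP; have [v [xv yv]] := laurent_lbounded2 x y.
have [w zw] := laurent_lbounded z; exact: lconvDl xv yv zw.
Qed.
Fact laurent_oner_neq0 : laurent_monom 1 0 != 0 :> laurent F.
Proof.
apply/eqP => /(congr1 (fun x : laurent F => x 0)) /= /eqP.
by rewrite /lmonom eqxx oner_eq0.
Qed.

HB.instance Definition _ := GRing.Zmodule_isComNzRing.Build (laurent F)
  laurent_mulA laurent_mulC laurent_mul1 laurent_mulDl laurent_oner_neq0.

Lemma lcoef0 n : (0 : laurent F) n = 0. Proof. by []. Qed.
Lemma lcoefN x n : (- x) n = - x n. Proof. by []. Qed.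
Lemma lcoefD x y n : (x + y) n = x n + y n. Proof. by []. Qed.
Lemma lcoefM x y n : (x * y) n = lconv x y n. Proof. by []. Qed.
Lemma lcoef1 n : (1 : laurent F) n = if n == 0 then 1 else 0.
Proof. by []. Qed.

Lemma laurent_inv_exists (x : laurent F) : x != 0 -> exists y, y * x = 1.
Proof.
move=> x0; have [w xw] := laurent_lbounded x.
have [k0 xk0] : exists k : nat, x (w + k%:Z) != 0.
  apply/not_existsP => xE; case/eqP: x0; apply: laurentP => n /=.
  case: (ltP n w) => [/xw //|wn]; have := xE (absz (n - w)%R).
  have -> : w + (absz (n - w)%R)%:Z = n by lia.
  by move=> /negP; rewrite negbK => /eqP ->.
have /ex_minnP[k xk kmin] : exists k : nat, x (w + k%:Z) != 0 by exists k0.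
pose v := w + k%:Z.
have xv : lbounded x v.
  move=> n nv; case: (ltP n w) => [/xw //|wn].
  apply/eqP/negPn/negP => xn.
  have nE : n = w + (absz (n - w)%R)%:Z by lia.
  by rewrite nE in xn; have := kmin _ xn; lia.
pose b (i : nat) := x (v + i%:Z).
pose g (n : int) := if n < - v then 0 else pinv b (absz (n + v)%R).
have gv : lbounded g (- v) by move=> n nv; rewrite /g nv.
have gfin : finite_set [set n : int | n < 0 /\ g n != 0].
  by apply/finite_lbounded; exists (- v).
exists (Laurent gfin); rewrite mulrC; apply: laurentP => n.
rewrite lcoefM lcoef1 /=.
case: (ltP n 0) => n0.
  by rewrite (lbounded_conv xv gv) ?ifN//; lia.
have -> : n = v + - v + `|n|%N%:Z by lia.
rewrite lconv_sum// (eq_bigr (fun i : 'I_`|n|%N.+1 =>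
    b i * pinv b (`|n| - i)%N)); last first.
  move=> i _; rewrite /b; congr (_ * _).
  by rewrite /g ifN; [congr (pinv _ _); lia | lia].
rewrite pinvP; last by rewrite /b addr0.
by rewrite subrr add0r; case: (`|n|%N).
Qed.

(* By convention the inverse of 0 is 0. *)
Definition laurent_inv (x : laurent F) : laurent F :=
  xget 0 [set y | y * x = 1].

Fact laurent_mulVf (x : laurent F) : x != 0 -> laurent_inv x * x = 1.
Proof.
by move=> /laurent_inv_exists ex; rewrite /laurent_inv; case: xgetP => [y _ //|];
  case: ex => y yx /(_ y).
Qed.
Fact laurent_inv0 : laurent_inv 0 = 0.
Proof.
rewrite /laurent_inv; case: xgetP => [y _ /= /eqP|//].
by rewrite mulr0 eq_sym oner_eq0.
Qed.

HB.instance Definition _ := GRing.ComNzRing_isField.Build (laurent F)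
  laurent_mulVf laurent_inv0.

End LaurentField.

Definition laurentC (F : fieldType) (c : F) : laurent F := laurent_monom c 0.
Definition laurentz (F : fieldType) : laurent F := laurent_monom 1 (-1).

Lemma laurent_gen_finite (F : fieldType) (c : nat -> F) :
  finite_set [set n : int |
    n < 0 /\ (if n is Posz m.+1 then c m else 0) != 0].
Proof. by apply/finite_lbounded; exists 0; case. Qed.

(* \sum_(n >= 0) c_n z^(-n-1) *)
Definition laurent_gen (F : fieldType) (c : nat -> F) : laurent F :=
  Laurent (laurent_gen_finite c).

(** * Lattice paths *)

(* [None] is the upstep; [Some j] is the step going down by j, which is a level
   step for j = 0. *)
Definition lstep (p : nat) := option 'I_p.+1.

Definition vertex := (nat * int)%type.

Definition step_end p (v : vertex) (s : lstep p) : vertex :=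
  (v.1.+1, if s is Some j then v.2 - (j : nat)%:Z else v.2 + 1).

Record lpath (p : nat) := LPath { lp_start : vertex; lp_steps : seq (lstep p) }.

Definition lp_tail p (g : lpath p) : seq vertex :=
  scanl (@step_end p) (lp_start g) (lp_steps g).

Definition lp_end p (g : lpath p) : vertex := last (lp_start g) (lp_tail g).

Definition lp_min p (g : lpath p) : int :=
  foldr (fun v : vertex => Order.min v.2) (lp_start g).2 (lp_tail g).

Definition lp_shift p (g : lpath p) (q : int) : lpath p :=
  LPath ((lp_start g).1, (lp_start g).2 + q) (lp_steps g).

Section Weights.
Variables (F : fieldType) (p : nat) (a : 'I_p.+1 -> int -> F).

(* The lower index of the weight is the height at which the step ends. *)
Definition step_weight (v : vertex) (s : lstep p) : F :=
  if s is Some j then a j (step_end v s).2 else 1.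

Fixpoint steps_weight (v : vertex) (s : seq (lstep p)) : F :=
  if s is x :: s' then step_weight v x * steps_weight (step_end v x) s' else 1.

Definition lp_weight (g : lpath p) : F := steps_weight (lp_start g) (lp_steps g).

End Weights.

Definition path0 p n (s : n.-tuple (lstep p)) : lpath p := LPath (0%N, 0) s.

(* D_[n,j]; a path starting at (0,0) is identified with its sequence of steps. *)
Definition Dset p n j : {set n.-tuple (lstep p)} :=
  [set s | (lp_end (path0 s) == (n, j%:Z)) && (lp_min (path0 s) == 0)].

Definition Acoef (F : fieldType) p (a : 'I_p.+1 -> int -> F) (q n j : nat) : F :=
  \sum_(s in Dset p n j) lp_weight a (lp_shift (path0 s) q%:Z).

(* A_j^(q)(z) *)
Definition Aser (F : fieldType) p (a : 'I_p.+1 -> int -> F) (q j : nat) :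
    laurent F :=
  laurent_gen (fun n => Acoef a q n j).

(* Main.v *)
(* Removing the last step of a path from (0,0) gives a linear recursion in n
   for the coefficients A^(q)_[n,j], valid for all j >= 0.  With this
   recursion, an induction on n shows that A_[n,j+1] is the convolution of
   A_[.,0] and A^(1)_[.,j] (cut the path at its last visit to height 0, which
   is followed by an upstep), i.e. the second identity.  For j = 0 the recursion
   reads z A_0 = 1 + \sum_j a^(j)_0 A_j; substituting the second identity and
   solving for A_0 gives the first one. *)
Require Import Defs.
From mathcomp Require Import all_boot all_order all_algebra.
From mathcomp Require Import classical_sets fsbigop.
From mathcomp Require Import reals complex.
From mathcomp Require Import zify.

Set Implicit Arguments.
Unset Strict Implicit.
Unset Printing Implicit Defensive.

Import Order.TTheory GRing.Theory Num.Theory.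
Local Open Scope ring_scope.
Local Open Scope complex_scope.

Section LaurentGen.
Variable F : fieldType.
Implicit Types (c d : nat -> F) (x : laurent F).

Lemma lcoef_monomM (b : F) (m : int) x n :
  (laurent_monom b m * x) n = b * x (n - m).
Proof.
rewrite lcoefM /lconv (fsbigE [:: m])//; last first.
  by move=> i _; rewrite inE /= /lmonom => /negbTE ->; rewrite mul0r.
by rewrite big_cons big_nil in_setT /= /lmonom eqxx addr0.
Qed.

Lemma lcoef_sum I (r : seq I) (P : pred I) (f : I -> laurent F) n :
  (\sum_(i <- r | P i) f i) n = \sum_(i <- r | P i) f i n.
Proof. exact: (big_morph (fun x : laurent F => x n)). Qed.

Lemma lbounded_gen c : lbounded (laurent_gen c) 1.
Proof. by case=> [[|n]|n]. Qed.

Lemma laurent_genM c d :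
  laurent_gen c * laurent_gen d =
  laurent_gen (fun n => if n is k.+1 then \sum_(i < n) c i * d (k - i)%N else 0).
Proof.
have [cb db] := (@lbounded_gen c, @lbounded_gen d).
apply: laurentP => n; rewrite lcoefM.
case: (ltP n 2) => n2.
  by rewrite (lbounded_conv cb db)//; case: n n2 => [[|[|n]]|n].
have -> : n = 1 + 1 + (absz (n - 2)%R)%:Z by lia.
by move: (absz _) => k; rewrite lconv_sum.
Qed.

Lemma laurentz_gen c :
  laurentz F * laurent_gen c = laurentC (c 0%N) + laurent_gen (fun n => c n.+1).
Proof.
apply: laurentP => n; rewrite lcoef_monomM mul1r lcoefD /= /lmonom opprK.
case: n => [n|[|n]].
- rewrite -PoszD addn1 /=; case: n => [|n] /=; last by rewrite add0r.
  by rewrite addr0.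
- by rewrite addr0.
- by rewrite addr0 (_ : Negz n.+1 + 1 = Negz n) //; lia.
Qed.

End LaurentGen.

Lemma big_tuple_rcons (V : nmodType) (T : finType) n (f : seq T -> V)
    (P : pred (seq T)) :
  \sum_(s : n.+1.-tuple T | P s) f s =
  \sum_(x : T) \sum_(s : n.-tuple T | P (rcons s x)) f (rcons s x).
Proof.
rewrite pair_big_dep /=.
pose h (u : T * n.-tuple T) : n.+1.-tuple T := [tuple of rcons u.2 u.1].
rewrite (reindex h) //=.
exists (fun s => (last (thead s) s, [tuple of belast (thead s) (behead s)])).
- move=> [x s] _; congr (_, _); first by rewrite /= last_rcons.
  apply: val_inj; rewrite /= /thead (tnth_nth x) /=.
  by case: s => [[|y s] ss] //=; rewrite belast_rcons.
- move=> s _; apply: val_inj => /=.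
  by case/tupleP: s => y s; rewrite theadE /= -lastI.
Qed.

Section Paths.
Variable p : nat.
Implicit Types (s : seq (lstep p)) (v : vertex) (x : lstep p).

Lemma lp_endE v s : lp_end (LPath v s) = foldl (@step_end p) v s.
Proof. by rewrite /lp_end /lp_tail /=; elim: s v => //= x s IH v. Qed.

Lemma foldl_step_end v s :
  foldl (@step_end p) v s =
  ((v.1 + size s)%N, v.2 + (foldl (@step_end p) (0%N, 0) s).2).
Proof.
elim/last_ind: s => [|s x IH]; first by rewrite /= addn0 addr0; case: v.
rewrite !foldl_rcons IH /step_end /= size_rcons addnS.
by case: x => [k|]; rewrite addrA.
Qed.

Lemma lp_min_rcons v s x :
  lp_min (LPath v (rcons s x)) =
  Order.min (lp_min (LPath v s)) (lp_end (LPath v (rcons s x))).2.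
Proof.
rewrite lp_endE foldl_rcons /lp_min /lp_tail /=.
move: (v.2) => w; elim: s v w => [|y s IH] v w /=; first by rewrite minC.
by rewrite IH minA.
Qed.

Lemma lp_min_le_end v s : lp_min (LPath v s) <= (lp_end (LPath v s)).2.
Proof.
case/lastP: s => [|s x]; first by rewrite /lp_min /lp_end.
by rewrite lp_min_rcons ge_min lexx orbT.
Qed.

Lemma lp_min_le_start v s : lp_min (LPath v s) <= v.2.
Proof.
elim/last_ind: s => [|s x IH]; first by rewrite /lp_min.
by rewrite lp_min_rcons ge_min IH.
Qed.

Lemma lp_end_path0 n (s : n.-tuple (lstep p)) :
  lp_end (path0 s) = (n, (lp_end (path0 s)).2).
Proof. by rewrite lp_endE foldl_step_end /= size_tuple !add0r. Qed.

Lemma Dset_rcons n j (s : n.-tuple (lstep p)) x :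
  ([tuple of rcons s x] \in Dset p n.+1 j) =
  if x is Some k then s \in Dset p n (j + k)
  else if j is j'.+1 then s \in Dset p n j' else false.
Proof.
have endE : lp_end (path0 [tuple of rcons s x]) = step_end (lp_end (path0 s)) x.
  by rewrite !lp_endE /= foldl_rcons.
have minE : lp_min (path0 [tuple of rcons s x]) =
    Order.min (lp_min (path0 s)) (step_end (lp_end (path0 s)) x).2.
  by rewrite -endE -lp_min_rcons.
have le0 : lp_min (path0 s) <= 0 by exact: lp_min_le_start.
have leE : lp_min (path0 s) <= (lp_end (path0 s)).2 by exact: lp_min_le_end.
have eqDset i : (s \in Dset p n i) =
    ((lp_end (path0 s)).2 == i) && (lp_min (path0 s) == 0).
  by rewrite inE {1}lp_end_path0 xpair_eqE eqxx.
rewrite inE endE minE lp_end_path0 /step_end /= xpair_eqE eqxx /=.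
move: (lp_min _) (lp_end _).2 le0 leE eqDset => m h le0 leE eqDset.
case: x {endE minE} => [k|]; last case: j => [|j]; rewrite ?eqDset; lia.
Qed.

End Paths.

Lemma big_option (V : nmodType) (T : finType) (f : option T -> V) :
  \sum_x f x = f None + \sum_k f (Some k).
Proof.
rewrite (bigD1 None) //=; congr (_ + _).
by rewrite (reindex_omap Some id) => [|[]]//=; apply: eq_bigl => k; rewrite eqxx.
Qed.

Section Coefficients.
Variables (F : fieldType) (p : nat) (a : 'I_p.+1 -> int -> F).

Lemma steps_weight_rcons v (s : seq (lstep p)) x :
  steps_weight a v (rcons s x) =
  steps_weight a v s * step_weight a (foldl (@step_end p) v s) x.
Proof. by elim: s v => [|y s IH] v /=; rewrite ?mulr1 ?mul1r// IH mulrA. Qed.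

Lemma Acoef0 q j : Acoef a q 0 j = (j == 0%N)%:R.
Proof.
rewrite /Acoef big_mkcond /= (big_pred1 [tuple]) => [|s]; last first.
  by apply/esym/eqP; exact: tuple0.
by rewrite inE; case: j.
Qed.

Lemma AcoefS q n j :
  Acoef a q n.+1 j =
  (if j is j'.+1 then Acoef a q n j' else 0) +
  \sum_(k < p.+1) a k (q + j)%N%:Z * Acoef a q n (j + k).
Proof.
rewrite /Acoef big_mkcond /=.
pose f (s : seq (lstep p)) : F :=
  if (lp_end (LPath (0%N, 0) s) == (n.+1, j%:Z)) &&
     (lp_min (LPath (0%N, 0) s) == 0)
  then lp_weight a (lp_shift (LPath (0%N, 0) s) q%:Z) else 0.
rewrite (eq_bigr (fun s : n.+1.-tuple (lstep p) => f s)) => [|s _]; last first.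
  by rewrite inE.
rewrite (big_tuple_rcons n f xpredT) big_option.
have fE (s : n.-tuple (lstep p)) x :
    f (rcons s x) = if [tuple of rcons s x] \in Dset p n.+1 j
      then lp_weight a (lp_shift (path0 s) q%:Z) *
           step_weight a (n, (lp_end (path0 s)).2 + q%:Z) x else 0.
  rewrite /f inE /=; case: ifP => // _.
  rewrite /lp_weight /= steps_weight_rcons lp_endE foldl_step_end /=.
  by rewrite size_tuple !add0r [_ + q%:Z]addrC.
congr (_ + _).
  case: j @f fE => [|j] f fE.
    by rewrite big1// => s _; rewrite fE Dset_rcons.
  rewrite [RHS]big_mkcond; apply: eq_bigr => s _; rewrite fE Dset_rcons /=.
  by rewrite mulr1.
apply: eq_bigr => k _; rewrite mulr_sumr [RHS]big_mkcond; apply: eq_bigr => s _.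
rewrite fE Dset_rcons; case: ifP => //; rewrite inE => /andP[/eqP -> _] /=.
by rewrite mulrC; congr (a _ _ * _); lia.
Qed.

Lemma Acoef_conv n j :
  Acoef a 0 n j.+1 =
  if n is m.+1 then \sum_(i < n) Acoef a 0 i 0 * Acoef a 1 (m - i) j else 0.
Proof.
elim: n j => [|n IH] j; first by rewrite Acoef0.
rewrite AcoefS [RHS]big_ord_recr /= subnn Acoef0.
under eq_bigr => k _ do rewrite addSn IH.
case: n IH => [|n] IH.
  rewrite big_ord0 add0r big1 ?addr0 => [|k _]; last by rewrite mulr0.
  by case: j => [|j]; rewrite ?mulr1// Acoef0 mulr0.
under [in RHS]eq_bigr => i _.
  rewrite subSn; last by rewrite -ltnS ltn_ord.
  rewrite AcoefS mulrDr mulr_sumr; over.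
rewrite big_split /= exchange_big /= addrAC; congr (_ + _); last first.
  apply: eq_bigr => k _; rewrite mulr_sumr; apply: eq_bigr => i _.
  by rewrite mulrCA.
case: j => [|j]; last by rewrite mulr0 addr0 IH.
by rewrite mulr1 big1 ?add0r// => i _; rewrite mulr0.
Qed.

Lemma Aser_succ j : Aser a 0 j.+1 = Aser a 0 0 * Aser a 1 j.
Proof.
rewrite laurent_genM; apply: laurentP => -[[|n]|n] //=.
exact: Acoef_conv.
Qed.

Lemma laurentz_Aser0 :
  laurentz F * Aser a 0 0 = 1 + \sum_(j < p.+1) laurentC (a j 0) * Aser a 0 j.
Proof.
rewrite laurentz_gen Acoef0; congr (_ + _).
apply: laurentP => n; rewrite lcoef_sum.
under eq_bigr => j _ do rewrite lcoef_monomM subr0.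
case: n => [[|n]|n] /=; last by rewrite big1// => j _; rewrite mulr0.
  by rewrite big1// => j _; rewrite mulr0.
by rewrite AcoefS add0r.
Qed.

End Coefficients.

Theorem theorem1p3 (R : realType) (p : nat) (hp : (1 <= p)%N)
    (a : 'I_p.+1 -> int -> R[i]) :
  Aser a 0 0 =
    1 / (laurentz R[i] - laurentC (a ord0 0)
         - \sum_(j < p.+1 | (1 <= j)%N) laurentC (a j 0) * Aser a 1 j.-1)
  /\
  forall j : nat, (1 <= j <= p)%N -> Aser a 0 j = Aser a 0 0 * Aser a 1 j.-1.
Proof.
split; last by case=> // j _; exact: Aser_succ.
set D := (X in 1 / X).
suff AD1 : Aser a 0 0 * D = 1.
  have D0 : D != 0 by apply: contra_eq_neq AD1 => ->; rewrite mulr0 eq_sym oner_neq0.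
  by rewrite -AD1 mulfK.
rewrite /D !mulrBr mulrC laurentz_Aser0 (bigD1 ord0) //= mulr_sumr.
rewrite [Aser a 0 0 * _]mulrC addrA addrAC addrK.
apply/eqP; rewrite subr_eq; apply/eqP; congr (_ + _).
apply: eq_big => [j|j]; first by rewrite lt0n.
by rewrite -lt0n; case: j => [[|j] jp] //= _; rewrite Aser_succ mulrCA.
Qed.
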